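(* Let $\mathcal{U}_1$ and $\mathcal{U}_2$ be proper geodesic $\mathrm{CAT}(0)$ spaces, let $A_1\subset\mathcal{U}_1$ and $A_2\subset\mathcal{U}_2$ be nonempty closed convex sets, and let $\iota\colon A_1\to A_2$ be an isometry. Then the gluing of $\mathcal{U}_1$ and $\mathcal{U}_2$ along $\iota$ is a proper geodesic $\mathrm{CAT}(0)$ space.
   Context: Write $|x-y|$ for the distance in a metric space. A geodesic is a distance-preserving map from a real interval; a metric space is geodesic if any two of its points are joined by a geodesic, and proper if all closed bounded sets are compact. A set $A$ in a metric space is convex if for every two points $p,q\in A$ every geodesic from $p$ to $q$ in the space lies in $A$. $\mathrm{CAT}(0)$: a metric space $\mathcal{X}$ is $\mathrm{CAT}(0)$ if every quadruple $p,q,x,y\in\mathcal{X}$ satisfies the following. Let $[\tilde p\tilde x\tilde y]$ and $[\tilde q\tilde x\tilde y]$ be triangles in the Euclidean plane $\mathbb{E}^2$ with common side $[\tilde x\tilde y]$ and with the same side lengths as the triples $(p,x,y)$ and $(q,x,y)$. Then $|p-q|_{\mathcal X}\le|\tilde p-\tilde z|+|\tilde z-\tilde q|$ for every $\tilde z\in[\tilde x\tilde y]$. Gluing: the gluing $\mathcal{W}$ of $\mathcal{U}_1$ and $\mathcal{U}_2$ along $\iota$ is the quotient set of $\mathcal{U}_1\sqcup\mathcal{U}_2$ by the equivalence relation generated by $a\sim\iota(a)$, $a\in A_1$. When $\mathcal{U}_i$ are proper and geodesic and $A_i$ are closed and convex, its metric is given by $|x-y|_{\mathcal W}=|x-y|_{\mathcal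 U_i}$ if $x,y\in\mathcal{U}_i$, and $|x-y|_{\mathcal W}=\min\{|x-a|_{\mathcal U_1}+|y-\iota(a)|_{\mathcal U_2}: a\in A_1\}$ if $x\in\mathcal{U}_1$, $y\in\mathcal{U}_2$. *)

(* Defs.v *)
From HB Require Import structures.
From Stdlib Require Import Relation_Operators.
From mathcomp Require Import all_boot all_order all_algebra generic_quotient lra.
From mathcomp Require Import all_classical all_reals all_analysis.

Set Implicit Arguments.
Unset Strict Implicit.
Unset Printing Implicit Defensive.

Import Order.TTheory GRing.Theory Num.Theory.
Import numFieldNormedType.Exports.

Local Open Scope classical_set_scope.
Local Open Scope ring_scope.
Local Open Scope quotient_scope.

Section metric_notions.
Context {R : realType}.

(* Only the values of gam on I matter. *)
Definition is_geodesic {X : metricType R} (I : interval R) (gam : R -> X) :=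
  {in I &, forall s t, mdist (gam s) (gam t) = `|s - t|}.

Definition geodesic_from_to {X : metricType R}
    (a b : R) (gam : R -> X) (p q : X) :=
  [/\ a <= b, is_geodesic `[a, b] gam, gam a = p & gam b = q].

Definition geodesic_space (X : metricType R) :=
  forall p q : X, exists a b gam, geodesic_from_to a b gam p q.

Definition bounded_subset {X : metricType R} (A : set X) :=
  exists M : R, forall x y, A x -> A y -> mdist x y <= M.

Definition proper_space (X : metricType R) :=
  forall A : set X, closed A -> bounded_subset A -> compact A.

Definition convex_subset {X : metricType R} (A : set X) :=
  forall p q, A p -> A q -> forall a b gam, geodesic_from_to a b gam p q ->
    forall t, t \in `[a, b] -> A (gam t).

(* The library's norm on 'rV[R]_2 is the sup norm, hence the explicit formula
   for the distance of the Euclidean plane. *)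
Definition plane_dist (u v : 'rV[R]_2) : R :=
  Num.sqrt (\sum_(i < 2) (u 0 i - v 0 i) ^+ 2).

Definition plane_segment (u v : 'rV[R]_2) : set 'rV[R]_2 :=
  [set (1 - t) *: u + t *: v | t in `[0, 1]].

Definition model_triangle {X : metricType R}
    (p x y : X) (p' x' y' : 'rV[R]_2) :=
  [/\ plane_dist p' x' = mdist p x,
      plane_dist p' y' = mdist p y &
      plane_dist x' y' = mdist x y].

Definition cat0_space (X : metricType R) :=
  forall (p q x y : X) (p' q' x' y' : 'rV[R]_2),
    model_triangle p x y p' x' y' -> model_triangle q x y q' x' y' ->
    forall z', plane_segment x' y' z' ->
      mdist p q <= plane_dist p' z' + plane_dist z' q'.

(* iota, restricted to A1, is an isometry from A1 onto A2; its values outside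
   A1 are irrelevant. *)
Definition isometry_between {X Y : metricType R}
    (A1 : set X) (A2 : set Y) (iota : X -> Y) :=
  set_bij A1 A2 iota /\
  forall a b, A1 a -> A1 b -> mdist (iota a) (iota b) = mdist a b.

End metric_notions.

Section gluing_set.
Context {R : realType} {U1 U2 : metricType R} (A1 : set U1) (iota : U1 -> U2).

Definition glue_step (u v : U1 + U2) : Prop :=
  exists2 a, A1 a & u = inl a /\ v = inr (iota a).

Definition glue_rel (u v : U1 + U2) : bool :=
  `[< clos_refl_sym_trans _ glue_step u v >].

Fact glue_rel_refl : reflexive glue_rel.
Proof. by move=> u; apply/asboolP; exact: rst_refl. Qed.

Fact glue_rel_sym : symmetric glue_rel.
Proof. by move=> u v; apply/asboolP/asboolP; exact: rst_sym. Qed.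

Fact glue_rel_trans : transitive glue_rel.
Proof.
move=> v u w /asboolP uv /asboolP vw; apply/asboolP.
exact: rst_trans uv vw.
Qed.

Canonical glue_equiv : equiv_rel (U1 + U2)%type :=
  EquivRel glue_rel glue_rel_refl glue_rel_sym glue_rel_trans.

Definition gluing_set := {eq_quot glue_equiv}.

(* The infimum is attained when U1 is proper, see gluing_dist12_min below. *)
Definition glue_dist12 (x : U1) (y : U2) : R :=
  inf [set mdist x a + mdist y (iota a) | a in A1].

Definition glue_dist (u v : U1 + U2) : R :=
  match u, v with
  | inl x, inl y => mdist x y
  | inr x, inr y => mdist x y
  | inl x, inr y => glue_dist12 x y
  | inr y, inl x => glue_dist12 x y
  end.

End gluing_set.

Section gluing.
Context {R : realType} {U1 U2 : metricType R}.
Context {A1 : set U1} {A2 : set U2} {iota : U1 -> U2}.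
Context (A1n0 : A1 !=set0) (A1c : closed A1).
Context (iotaI : isometry_between A1 A2 iota).

Local Notation d12 := (glue_dist12 A1 iota).
Local Notation d := (glue_dist A1 iota).

Let iota_dist a b : A1 a -> A1 b -> mdist (iota a) (iota b) = mdist a b.
Proof. by case: iotaI => _; exact. Qed.

Let d12_lb x y r :
  (forall a, A1 a -> r <= mdist x a + mdist y (iota a)) -> r <= d12 x y.
Proof.
move=> H; apply: lb_le_inf.
  by case: A1n0 => a A1a; exists (mdist x a + mdist y (iota a)), a.
by move=> _ [a A1a <-]; exact: H.
Qed.

Let d12_le x y a : A1 a -> d12 x y <= mdist x a + mdist y (iota a).
Proof.
move=> A1a; apply: ge_inf; last by exists a.
by exists 0 => _ [b _ <-]; rewrite addr_ge0// mdist_ge0.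
Qed.

Let d12_ge0 x y : 0 <= d12 x y.
Proof. by apply: d12_lb => a _; rewrite addr_ge0// mdist_ge0. Qed.

Let d12_lt x y r : d12 x y < r ->
  exists2 a, A1 a & mdist x a + mdist y (iota a) < r.
Proof.
move=> lt_r; apply: contrapT => H; move: lt_r; rewrite ltNge => /negP; apply.
apply: d12_lb => a A1a; rewrite leNgt; apply/negP => ltr.
by apply: H; exists a.
Qed.

Let d_ge0 u v : 0 <= d u v.
Proof. by case: u v => [x|x] [y|y] /=; rewrite ?mdist_ge0. Qed.

Let d_refl u : d u u = 0.
Proof. by case: u => x /=; rewrite mdistxx. Qed.

Let d_sym u v : d u v = d v u.
Proof. by case: u v => [x|x] [y|y] //=; rewrite metric_sym. Qed.

Let d12_triangle1 x x' y : d12 x y <= mdist x x' + d12 x' y.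
Proof.
rewrite -lerBlDl; apply: d12_lb => a A1a.
by have := d12_le x y A1a; have := metric_triangle x x' a; lra.
Qed.

Let d12_triangle2 x y y' : d12 x y <= d12 x y' + mdist y' y.
Proof.
rewrite -lerBlDr; apply: d12_lb => a A1a.
have := d12_le x y A1a; have := metric_triangle y y' (iota a).
by rewrite (metric_sym y y'); lra.
Qed.

Let triangle1 x y x' : mdist x x' <= d12 x y + d12 x' y.
Proof.
rewrite -lerBlDl; apply: d12_lb => b A1b; rewrite lerBlDl -lerBlDr.
apply: d12_lb => a A1a; have := iota_dist A1a A1b.
have := metric_triangle x a x'; have := metric_triangle a b x'.
have := metric_triangle (iota a) y (iota b).
by rewrite (metric_sym b x') (metric_sym (iota a) y); lra.
Qed.

Let triangle2 x y y' : mdist y y' <= d12 x y + d12 x y'.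
Proof.
rewrite -lerBlDl; apply: d12_lb => b A1b; rewrite lerBlDl -lerBlDr.
apply: d12_lb => a A1a; have := iota_dist A1a A1b.
have := metric_triangle y (iota a) y'.
have := metric_triangle (iota a) (iota b) y'; have := metric_triangle a x b.
by rewrite (metric_sym (iota b) y') (metric_sym a x); lra.
Qed.

Let d_triangle v u w : d u w <= d u v + d v w.
Proof.
case: u v w => [x|x] [y|y] [z|z] /=.
- exact: metric_triangle.
- exact: d12_triangle1.
- exact: triangle1.
- exact: d12_triangle2.
- by rewrite addrC (metric_sym y z); exact: d12_triangle1.
- exact: triangle2.
- by rewrite addrC (metric_sym x y); exact: d12_triangle2.
- exact: metric_triangle.
Qed.

Let d12_eq0 x y : d12 x y = 0 -> A1 x /\ y = iota x.
Proof.
move=> d0.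
have near e : 0 < e -> exists2 a, A1 a & mdist x a + mdist y (iota a) < e.
  by move=> e0; apply: d12_lt; rewrite d0.
have A1x : A1 x.
  apply: A1c => B /nbhs_ballP[e /= e0 eB].
  have [a A1a lt_e] := near e e0; exists a; split => //; apply: eB.
  rewrite ballEmdist /=; apply: le_lt_trans lt_e.
  by rewrite lerDl mdist_ge0.
split => //; apply: mdist_positivity; apply/eqP; rewrite eq_le mdist_ge0 andbT.
apply/ler_addgt0Pl => e e0; rewrite addr0.
have [a A1a lt_e] := near e e0; apply/ltW; apply: le_lt_trans lt_e.
apply: le_trans (metric_triangle y (iota a) (iota x)) _.
by rewrite addrC lerD2r iota_dist// metric_sym.
Qed.

Let d_eq0 u v : d u v = 0 -> glue_rel A1 iota u v.
Proof.
case: u v => [x|x] [y|y] /= d0; apply/asboolP.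
- by rewrite (mdist_positivity _ _ d0); exact: rst_refl.
- by have [A1x ->] := d12_eq0 d0; apply: rst_step; exists x.
- have [A1y ->] := d12_eq0 d0; apply: rst_sym.
  by apply: rst_step; exists y.
- by rewrite (mdist_positivity _ _ d0); exact: rst_refl.
Qed.

Let d_rel u v : glue_rel A1 iota u v -> d u v = 0.
Proof.
move=> /asboolP; elim=> {u v} [_ _ [a A1a [-> ->]]|u|u v _|u v w _ uv _ vw] /=.
- apply/eqP; rewrite eq_le d12_ge0 andbT.
  by apply: le_trans (d12_le a (iota a) A1a) _; rewrite !mdistxx addr0.
- exact: d_refl.
- by rewrite d_sym.
- apply/eqP; rewrite eq_le d_ge0 andbT.
  by apply: le_trans (d_triangle v u w) _; rewrite uv vw addr0.
Qed.

(* The underlying set does not depend on the three hypotheses; they are what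
   makes the distance below a metric. *)
Definition gluing & A1 !=set0 & closed A1 & isometry_between A1 A2 iota : Type
  := gluing_set A1 iota.

Local Notation W := (gluing A1n0 A1c iotaI).

HB.instance Definition _ := Choice.copy W (gluing_set A1 iota).

Definition gluing_dist (p q : W) : R :=
  d (repr (p : gluing_set A1 iota)) (repr (q : gluing_set A1 iota)).

Let repr_rel u : glue_rel A1 iota (repr (\pi_(gluing_set A1 iota) u)) u.
Proof.
have /eqP := reprK (\pi_(gluing_set A1 iota) u).
by rewrite (@eqmodE _ (glue_equiv A1 iota)).
Qed.

Let dist_pi u v :
  gluing_dist (\pi_(gluing_set A1 iota) u) (\pi_(gluing_set A1 iota) v) = d u v.
Proof.
rewrite /gluing_dist; set u' := repr _; set v' := repr _.
have u'u : d u' u = 0 by exact/d_rel/repr_rel.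
have v'v : d v' v = 0 by exact/d_rel/repr_rel.
apply/eqP; rewrite eq_le; apply/andP; split.
  apply: le_trans (d_triangle u u' v') _; rewrite u'u add0r.
  by apply: le_trans (d_triangle v u v') _; rewrite (d_sym v v') v'v addr0.
apply: le_trans (d_triangle u' u v) _; rewrite (d_sym u u') u'u add0r.
by apply: le_trans (d_triangle v' u' v) _; rewrite v'v addr0.
Qed.

Let dist_refl p : gluing_dist p p = 0.
Proof. exact: d_refl. Qed.

Let dist_eq0 p q : gluing_dist p q = 0 -> p = q.
Proof.
move=> /d_eq0 pq.
rewrite -[p](@reprK _ (gluing_set A1 iota)) -[q](@reprK _ (gluing_set A1 iota)).
by apply/eqP; rewrite (@eqmodE _ (glue_equiv A1 iota)).
Qed.

Let dist_sym p q : gluing_dist p q = gluing_dist q p.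
Proof. exact: d_sym. Qed.

Let dist_triangle q p r : gluing_dist p r <= gluing_dist p q + gluing_dist q r.
Proof. exact: d_triangle. Qed.

HB.instance Definition _ :=
  @isMetric.Build R W gluing_dist dist_refl dist_eq0 dist_sym dist_triangle.

Definition gluing_inl (x : U1) : W := \pi_(gluing_set A1 iota) (inl x).
Definition gluing_inr (y : U2) : W := \pi_(gluing_set A1 iota) (inr y).

Lemma gluingP p : (exists x, p = gluing_inl x) \/ (exists y, p = gluing_inr y).
Proof.
elim/(@quotW _ (gluing_set A1 iota)): p => -[x|y]; first by left; exists x.
by right; exists y.
Qed.

Lemma gluing_dist11 x y : mdist (gluing_inl x) (gluing_inl y) = mdist x y.
Proof. exact: dist_pi. Qed.

Lemma gluing_dist22 x y : mdist (gluing_inr x) (gluing_inr y) = mdist x y.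
Proof. exact: dist_pi. Qed.

Lemma gluing_dist12 x y : mdist (gluing_inl x) (gluing_inr y) = d12 x y.
Proof. exact: dist_pi. Qed.

Lemma gluing_inl_inr x y :
  gluing_inl x = gluing_inr y <-> A1 x /\ y = iota x.
Proof.
split=> [xy|[A1x ->]].
  by apply: d12_eq0; rewrite -gluing_dist12 xy mdistxx.
apply: mdist_positivity; rewrite gluing_dist12; apply: (d_rel (u := inl x) (v := inr (iota x))).
by apply/asboolP/rst_step; exists x.
Qed.

Lemma gluing_dist12_min x y : proper_space U1 -> exists2 a, A1 a &
  mdist (gluing_inl x) (gluing_inr y) = mdist x a + mdist y (iota a) /\
  forall b, A1 b -> mdist x a + mdist y (iota a) <= mdist x b + mdist y (iota b).
Proof.
move=> U1p; rewrite gluing_dist12; have [a0 A1a0] := A1n0.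
pose f a := mdist x a + mdist y (iota a).
pose B := A1 `&` [set a | mdist x a <= f a0].
have f_lip a b : A1 a -> A1 b -> f b <= f a + mdist a b *+ 2.
  move=> A1a A1b; have := iota_dist A1a A1b; rewrite /f mulr2n.
  by have := metric_triangle x a b; have := metric_triangle y (iota a) (iota b); lra.
have Bc : compact B.
  apply: U1p.
    apply: closedI => // a cla; apply/ler_addgt0Pl => e e0.
    have [b [/= b_le]] := cla _ (nbhsx_ballx a e e0).
    rewrite ballEmdist /= => ab; have := metric_triangle x b a.
    by rewrite (metric_sym b a); lra.
  exists (f a0 + f a0) => a b [_ /= ale] [_ /= ble].
  by have := metric_triangle a x b; rewrite (metric_sym a x); lra.
have fB : {within B, continuous f}.
  apply/subspace_continuousP => a [A1a _].
  apply/cvgrPdist_le => e e0; rewrite near_withinE; apply/nbhs_ballP.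
  exists (e / 2); first by rewrite /= divr_gt0.
  move=> b; rewrite ballEmdist /= => ab [A1b _].
  have := f_lip _ _ A1a A1b; have := f_lip _ _ A1b A1a.
  rewrite (metric_sym b a) /from_subspace ler_norml !mulr2n.
  by lra.
have B0 : B !=set0.
  by exists a0; split => //=; rewrite /f lerDl mdist_ge0.
have [a /set_mem[A1a ax] a_min] := compact_EVT_min B0 Bc fB.
have f_min b : A1 b -> f a <= f b.
  move=> A1b; have [xb|xb] := leP (mdist x b) (f a0).
    by apply: a_min; apply/mem_set.
  have := a_min a0; rewrite inE => /(_ _) h.
  apply: le_trans (h _) _; first by split => //=; rewrite /f lerDl mdist_ge0.
  by apply: le_trans (ltW xb) _; rewrite /f lerDl mdist_ge0.
exists a => //; split => //; apply/eqP; rewrite eq_le d12_le//=.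
exact: d12_lb.
Qed.

End gluing.

(* Main.v *)
Require Import Defs.
From mathcomp Require Import all_boot all_order all_algebra ring lra.
From mathcomp Require Import all_classical all_reals all_analysis.

Set Implicit Arguments.
Unset Strict Implicit.
Unset Printing Implicit Defensive.

Import Order.TTheory GRing.Theory Num.Theory.

Local Open Scope classical_set_scope.

(** A geodesic space is CAT(0) iff the point z dividing [xy] in ratio t satisfies
    |pz|^2 <= (1-t)|px|^2 + t|py|^2 - t(1-t)|xy|^2 for all p (with equality in
    the plane, by Stewart's theorem), so only this inequality has to be checked
    in the gluing, for each distribution of p, x, y over the two pieces.

    If x, y lie in one piece and p in the other, the geodesics px and py cross
    the interface at points a and b, and p is joined to z by a path through a
    well chosen point of [ab]; the estimate is algebraic and rests on a weighted
    quadrilateral inequality for a, x, y, b. If x and y lie in different pieces,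
    the distance from p is controlled on both sides of the crossing point c of
    [xy], and it remains to treat z = c: for p on the interface this is the
    first variation inequality, c being a minimum of |xc| + |cy|; for other p
    it follows by a midline argument and a passage to the limit at c. *)

(** * Elementary inequalities for squares of distances *)

Section real_inequalities.
Context {R : realFieldType}.
Local Open Scope ring_scope.
Implicit Types (d u v g t : R).

(** The defect is a square that vanishes for [v = (g - 1) * u]. Below, [g] is the ratio of a path to
    its first portion in the plane, so that nothing is lost there. *)
Lemma sqr_le_weighted d u v g : 0 <= d -> d <= u + v -> 1 < g ->
  d ^+ 2 <= g * u ^+ 2 + g / (g - 1) * v ^+ 2.
Proof.
move=> d0 duv g1; have h0 : 0 < g - 1 by lra.
have hn0 : g - 1 != 0 by rewrite gt_eqF.
have : d ^+ 2 <= (u + v) ^+ 2 by rewrite lerXn2r// nnegrE; lra.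
move=> /le_trans; apply; rewrite -subr_ge0.
rewrite (_ : _ - _ = ((g - 1) * u - v) ^+ 2 / (g - 1)); last by field.
by rewrite divr_ge0// ?sqr_ge0// ltW.
Qed.

Lemma sqr_le_convex d u v t : 0 <= d -> 0 <= t <= 1 ->
  d <= (1 - t) * u + t * v -> d ^+ 2 <= (1 - t) * u ^+ 2 + t * v ^+ 2.
Proof.
move=> d0 t01 duv.
have : d ^+ 2 <= ((1 - t) * u + t * v) ^+ 2.
  by rewrite lerXn2r// nnegrE (le_trans d0).
move=> /le_trans; apply; rewrite -subr_ge0.
rewrite (_ : _ - _ = t * (1 - t) * (u - v) ^+ 2); last by ring.
by rewrite mulr_ge0 ?sqr_ge0// mulr_ge0; lra.
Qed.

Lemma ge0_of_affine u v : (forall e, 0 < e <= 1 -> 0 <= u + e * v) -> 0 <= u.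
Proof.
move=> H; rewrite leNgt; apply/negP => u0.
have v0 : 0 < v by have := H 1; lra.
(* This [e] is at most 1 and lies before the zero [- u / v] of the affine function. *)
have e0 : 0 < - u / (2 * v - u) <= 1.
  by rewrite divr_gt0/= ?ler_pdivrMr; lra.
have := H _ e0; apply/negP; rewrite -ltNge.
rewrite (_ : u + _ = u * (v - u) / (2 * v - u)); last by field; lra.
by rewrite pmulr_llt0 ?invr_gt0 ?pmulr_llt0; lra.
Qed.

End real_inequalities.

(** * Division points, Stewart's inequality and quadrilaterals *)

Section ratio_points.
Context {R : realType} {X : metricType R}.
Local Open Scope ring_scope.
Implicit Types (p x y z : X) (t : R) (S : set X).

Definition at_ratio t x y z :=
  mdist x z = t * mdist x y /\ mdist z y = (1 - t) * mdist x y.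

(* Stewart's theorem gives equality in the Euclidean plane when z divides the
   segment from x to y in ratio t. *)
Definition stewart_le t p x y z := mdist p z ^+ 2 <=
  (1 - t) * mdist p x ^+ 2 + t * mdist p y ^+ 2 - t * (1 - t) * mdist x y ^+ 2.

(** Being geodesic and CAT(0), stated for a subset by distances alone, so that no parametrized
    curves have to be cut or joined. *)
Definition cat0_piece S :=
  (forall x y t, S x -> S y -> 0 <= t <= 1 ->
     exists2 z, S z & at_ratio t x y z) /\
  (forall p x y z t, S p -> S x -> S y -> S z -> 0 <= t <= 1 ->
     at_ratio t x y z -> stewart_le t p x y z).

Lemma mdist_eq x y : mdist x y <= 0 -> x = y.
Proof. by move=> d0; apply: mdist_positivity; have := mdist_ge0 x y; lra. Qed.

Lemma at_ratio_sym t x y z : at_ratio t x y z -> at_ratio (1 - t) y x z.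
Proof.
move=> [xz zy]; split; first by rewrite metric_sym zy (metric_sym x y).
by rewrite subKr metric_sym xz (metric_sym x y).
Qed.

Lemma stewart_le_sym t p x y z :
  stewart_le (1 - t) p y x z -> stewart_le t p x y z.
Proof. by rewrite /stewart_le (metric_sym y x); lra. Qed.

Lemma at_ratio_uniq S t x y z z' : cat0_piece S -> S x -> S y -> S z -> S z' ->
  0 <= t <= 1 -> at_ratio t x y z -> at_ratio t x y z' -> z = z'.
Proof.
move=> [_ SS] Sx Sy Sz Sz' t01 xyz [xz' z'y].
have := SS z' _ _ _ _ Sz' Sx Sy Sz t01 xyz.
rewrite /stewart_le (metric_sym z' x) xz' z'y => le0; apply/esym/mdist_eq.
rewrite leNgt; apply/negP => d0; have : 0 < mdist z' z ^+ 2 by rewrite exprn_gt0.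
by apply/negP; rewrite -leNgt; apply: (le_trans le0); lra.
Qed.

(* Obtained by comparing the diagonal [ay] with the path from a to y through a
   suitable point m of the diagonal [bx]. In the plane, equality holds when the
   lines xa and yb meet at a point p with |px| = (1 + u)|pa| and
   |py| = (1 + w)|pb|. *)
Lemma cat0_quadrilateral S a x y b u w i j : cat0_piece S ->
  S a -> S x -> S y -> S b -> 0 <= u -> 0 <= w ->
  mdist a x = u * i -> mdist b y = w * j ->
  (1 + u) * mdist a y ^+ 2 + (1 + w) * mdist b x ^+ 2 <=
  w * u * (1 + u) * i ^+ 2 + u * w * (1 + w) * j ^+ 2 + mdist x y ^+ 2 +
  (1 + u) * (1 + w) * mdist a b ^+ 2.
Proof.
move=> [Sex SS] Sa Sx Sy Sb; rewrite le_eqVlt => /predU1P[<- _|u0].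
  by rewrite !mul0r => ax _; rewrite (@mdist_eq a x) ?ax// (metric_sym b x); lra.
rewrite le_eqVlt => /predU1P[<-|w0].
  rewrite !mul0r => _ yb; rewrite -(@mdist_eq b y) ?yb// (metric_sym b x); lra.
move=> axE byE.
have e0 : 0 < (1 + u) * (1 + w) - 1 by have := mulr_gt0 u0 w0; lra.
(* In the plane configuration, [m] is the intersection of the diagonals, and the weight used below
   is |ay| / |am|. *)
pose k := w / ((1 + u) * (1 + w) - 1).
have kC : 1 - k = u * (1 + w) / ((1 + u) * (1 + w) - 1).
  by rewrite /k; field; rewrite gt_eqF.
have k01 : 0 <= k <= 1.
  have k0 : 0 <= k by rewrite divr_ge0// ltW.
  by have : 0 <= 1 - k; [rewrite kC divr_ge0// ?mulr_ge0; lra | lra].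
have [m Sm bxm] := Sex b x k Sb Sx k01.
have am := SS a _ _ _ _ Sa Sb Sx Sm k01 bxm.
have ym := SS y _ _ _ _ Sy Sb Sx Sm k01 bxm.
have g1 : 1 < ((1 + u) * (1 + w) - 1) / u by rewrite ltr_pdivlMr; nra.
have := sqr_le_weighted (mdist_ge0 a y) (metric_triangle a m y) g1.
move: am ym; rewrite /stewart_le (metric_sym m y) (metric_sym y b).
rewrite (metric_sym y x) axE byE kC /k.
move: (mdist a y) (mdist a m) (mdist y m) (mdist a b) (mdist b x) (mdist x y).
move=> ay am ym ab bx xy lam lym.
set g := _ / u; set G := (X in X * ym ^+ 2) => lay.
have g0 : 0 < g by rewrite divr_gt0.
have G0 : 0 < G by rewrite divr_gt0// subr_gt0.
have : (1 + u) * ay ^+ 2 <= (1 + u) * (g *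
     (u * (1 + w) / ((1 + u) * (1 + w) - 1) * ab ^+ 2 +
      w / ((1 + u) * (1 + w) - 1) * (u * i) ^+ 2 -
      w / ((1 + u) * (1 + w) - 1) * (u * (1 + w) / ((1 + u) * (1 + w) - 1)) * bx ^+ 2)
   + G * (u * (1 + w) / ((1 + u) * (1 + w) - 1) * (w * j) ^+ 2 +
      w / ((1 + u) * (1 + w) - 1) * xy ^+ 2 -
      w / ((1 + u) * (1 + w) - 1) * (u * (1 + w) / ((1 + u) * (1 + w) - 1)) * bx ^+ 2)).
  rewrite ler_pM2l; last by lra.
  by apply: (le_trans lay); rewrite lerD// ler_pM2l.
move=> /(lerD (lexx ((1 + w) * bx ^+ 2))); rewrite addrC => /le_trans; apply.
rewrite le_eqVlt; apply/orP; left; apply/eqP; rewrite /G /g; field.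
have := mulr_gt0 u0 w0.
by rewrite !gt_eqF; nra.
Qed.

End ratio_points.

(** * Stewart's inequality across the interface *)

Section glued_pieces.
Context {R : realType} {X : metricType R}.
Local Open Scope ring_scope.
Implicit Types (p x y z a b c : X) (t : R) (S : set X).

Lemma at_ratio0 x y z : at_ratio 0 x y z -> z = x.
Proof. by move=> [xz _]; apply/esym/mdist_eq; rewrite xz mul0r. Qed.

Lemma stewart_le0 p x y : stewart_le 0 p x y x.
Proof. by rewrite /stewart_le; lra. Qed.

Lemma stewart_le1 p x y : stewart_le 1 p x y y.
Proof. by rewrite /stewart_le; lra. Qed.

(** The square of the right-hand side exceeds Stewart's bound by t(1-t)(|xy|^2 - (|px| - |py|)^2),
    which is nonnegative by the triangle inequality. *)
Lemma mdist_ratio_le S t p x y z : cat0_piece S -> S p -> S x -> S y -> S z ->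
  0 <= t <= 1 -> at_ratio t x y z ->
  mdist p z <= (1 - t) * mdist p x + t * mdist p y.
Proof.
move=> [_ SS] Sp Sx Sy Sz t01 xyz.
have := SS p _ _ _ _ Sp Sx Sy Sz t01 xyz; rewrite /stewart_le.
have := metric_triangle p x y; have := metric_triangle p y x.
have := metric_triangle x p y; rewrite (metric_sym y x) (metric_sym x p).
have := mdist_ge0 p x; have := mdist_ge0 p y; have := mdist_ge0 x y.
move: (mdist p z) (mdist p x) (mdist p y) (mdist x y) => d u v l.
move=> l0 v0 u0 luv ulv vul dle.
have rhs0 : 0 <= (1 - t) * u + t * v.
  by rewrite addr_ge0// mulr_ge0//; lra.
rewrite leNgt; apply/negP => lt_d.
have : ((1 - t) * u + t * v) ^+ 2 < d ^+ 2 by rewrite ltrXn2r// nnegrE; lra.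
apply/negP; rewrite -leNgt; apply: (le_trans dle).
rewrite -subr_ge0.
rewrite (_ : _ - _ = t * (1 - t) * ((l - u + v) * (l + u - v))); last by ring.
by rewrite mulr_ge0// mulr_ge0//; lra.
Qed.

(** The gluing seen from inside one space, the interface being the intersection. The last clause
    records that the minimum defining the glued distance is attained. *)
Definition glued_pieces (X1 X2 : set X) :=
  [/\ cat0_piece X1, cat0_piece X2,
      forall x y t, (X1 `&` X2) x -> (X1 `&` X2) y -> 0 <= t <= 1 ->
        exists2 z, (X1 `&` X2) z & at_ratio t x y z &
      forall x y, X1 x -> X2 y ->
        exists2 a, (X1 `&` X2) a & mdist x y = mdist x a + mdist a y].

Lemma glued_pieces_sym X1 X2 : glued_pieces X1 X2 -> glued_pieces X2 X1.
Proof.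
move=> [C1 C2 CA cross]; split => //; first by rewrite setIC.
move=> x y Xx Xy; have [a Aa ya] := cross y x Xy Xx.
exists a; first by rewrite setIC.
by rewrite metric_sym ya addrC (metric_sym x a) (metric_sym a y).
Qed.

(* The geodesic from p to z is estimated by a path through a point n of the
   segment [ab] of the interface. In the plane, the lines pz and ab meet at the
   point n with |pz| = g |pn| which divides [ab] in ratio r. *)
Lemma stewart_across X1 X2 t p x y z : glued_pieces X1 X2 ->
  X1 p -> X2 x -> X2 y -> X2 z -> 0 <= t <= 1 -> at_ratio t x y z ->
  stewart_le t p x y z.
Proof.
move=> [C1 C2 CA cross] Xp Xx Xy Xz t01 xyz.
have [a Aa pxE] := cross p x Xp Xx; have [b Ab pyE] := cross p y Xp Xy.
have [X1a X2a] := Aa; have [X1b X2b] := Ab.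
have [pa0|] := leP (mdist p a) 0.
  by apply: C2.2 Xx Xy Xz t01 xyz; rewrite (mdist_eq pa0).
have [pb0 _|] := leP (mdist p b) 0.
  by apply: C2.2 Xx Xy Xz t01 xyz; rewrite (mdist_eq pb0).
move=> pb0 pa0.
have [t0|t0] := leP t 0.
  have tE : t = 0 by lra.
  by move: xyz; rewrite tE => /at_ratio0 ->; exact: stewart_le0.
have [t1|t1] := leP 1 t.
  have tE : t = 1 by lra.
  move: xyz => /at_ratio_sym; rewrite tE subrr => /at_ratio0 ->.
  exact: stewart_le1.
pose u := mdist a x / mdist p a; pose w := mdist b y / mdist p b.
have uE : mdist a x = u * mdist p a by rewrite mulfVK// gt_eqF.
have wE : mdist b y = w * mdist p b by rewrite mulfVK// gt_eqF.
have u0 : 0 <= u by rewrite divr_ge0// ?mdist_ge0.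
have w0 : 0 <= w by rewrite divr_ge0// ?mdist_ge0.
pose g := (1 - t) * (1 + u) + t * (1 + w).
have [uw|uw] := leP (u + w) 0.
  have ax : a = x by apply: mdist_eq; rewrite uE (_ : u = 0) ?mul0r//; lra.
  have bY : b = y by apply: mdist_eq; rewrite wE (_ : w = 0) ?mul0r//; lra.
  rewrite -ax -bY in xyz *; have [z' [X1z' X2z'] abz'] := CA a b t Aa Ab t01.
  rewrite (at_ratio_uniq C2 X2a X2b Xz X2z' t01 xyz abz').
  exact: C1.2 Xp X1a X1b X1z' t01 abz'.
have g1 : 1 < g.
  suff : 0 < (1 - t) * u + t * w by rewrite /g; lra.
  have tu : 0 <= (1 - t) * u by rewrite mulr_ge0//; lra.
  have tw : 0 <= t * w by rewrite mulr_ge0//; lra.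
  have [u1|u1] := ltP 0 u.
    have : 0 < (1 - t) * u by rewrite mulr_gt0//; lra.
    lra.
  have : 0 < t * w by rewrite mulr_gt0//; lra.
  lra.
have g0 : 0 < g by lra.
(* With [p] as origin, z = (1-t)(1+u)a + t(1+w)b = g((1-r)a + rb). *)
pose r := t * (1 + w) / g.
have rC : 1 - r = (1 - t) * (1 + u) / g.
  by rewrite /r /g; field; rewrite gt_eqF.
have r01 : 0 <= r <= 1.
  have r0 : 0 <= r by rewrite divr_ge0 ?mulr_ge0//; lra.
  have : 0 <= 1 - r by rewrite rC divr_ge0 ?mulr_ge0//; lra.
  lra.
have [n [X1n X2n] abn] := CA a b r Aa Ab r01.
have pn := C1.2 p _ _ _ _ Xp X1a X1b X1n r01 abn.
have zn := C2.2 z _ _ _ _ Xz X2a X2b X2n r01 abn.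
have az := C2.2 a _ _ _ _ X2a Xx Xy Xz t01 xyz.
have bz := C2.2 b _ _ _ _ X2b Xx Xy Xz t01 xyz.
have Q := cat0_quadrilateral C2 X2a Xx Xy X2b u0 w0 uE wE.
have := sqr_le_weighted (mdist_ge0 p z) (metric_triangle p n z) g1.
move: pn zn az bz Q; rewrite /stewart_le (metric_sym n z).
rewrite (metric_sym z a) (metric_sym z b) pxE pyE uE wE rC /r.
move: (mdist p a) (mdist p b) (mdist a b) (mdist x y) (mdist p z) (mdist p n).
move: (mdist z n) (mdist a z) (mdist b z) (mdist a y) (mdist b x).
move=> zn az bz ay bx i j ab xy pz pn lpn lzn laz lbz Q /le_trans; apply.
have h0 : 0 < g - 1 by rewrite subr_gt0.
pose T := (1 - t) * (1 + u) / g * ((1 - t) * (u * i) ^+ 2 + t * ay ^+ 2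
    - t * (1 - t) * xy ^+ 2) + t * (1 + w) / g * ((1 - t) * bx ^+ 2 +
    t * (w * j) ^+ 2 - t * (1 - t) * xy ^+ 2) -
    t * (1 + w) / g * ((1 - t) * (1 + u) / g) * ab ^+ 2.
have lzn' : zn ^+ 2 <= T.
  apply: (le_trans lzn); rewrite lerD2r lerD// ler_wpM2l//.
    by rewrite -rC; lra.
  by rewrite -/r; lra.
(* The factor is chosen so that the diagonals [ay] and [bx] in [T] cancel against the quadrilateral
   inequality. *)
pose T' := T + t * (1 - t) / g * (w * u * (1 + u) * i ^+ 2 +
    u * w * (1 + w) * j ^+ 2 + xy ^+ 2 + (1 + u) * (1 + w) * ab ^+ 2 -
    ((1 + u) * ay ^+ 2 + (1 + w) * bx ^+ 2)).
have lT : T <= T'.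
  by rewrite lerDl mulr_ge0 ?subr_ge0// divr_ge0 ?mulr_ge0//; lra.
have l1 : g * pn ^+ 2 <= g * ((1 - t) * (1 + u) / g * i ^+ 2 +
    t * (1 + w) / g * j ^+ 2 -
    t * (1 + w) / g * ((1 - t) * (1 + u) / g) * ab ^+ 2).
  by rewrite ler_pM2l.
have l2 : g / (g - 1) * zn ^+ 2 <= g / (g - 1) * T'.
  by rewrite ler_pM2l ?divr_gt0//; apply: le_trans lT.
apply: (le_trans (lerD l1 l2)); rewrite le_eqVlt; apply/orP; left; apply/eqP.
move: h0 g0; rewrite /T' /T /g => h0 g0; field.
by rewrite !gt_eqF.
Qed.

(* First variation: c minimises the sum of the distances to x and y along the
   segment from c to b. *)
Lemma stewart_crossing_interface X1 X2 t b x y c : glued_pieces X1 X2 ->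
  (X1 `&` X2) b -> X1 x -> X2 y -> (X1 `&` X2) c -> 0 < t < 1 ->
  at_ratio t x y c -> stewart_le t b x y c.
Proof.
move=> [C1 C2 CA _] Ab Xx Xy Ac t01 [xc cy].
(* Moving [c] towards [b] by the ratio [e] gives, after division by [e], the claim up to the error
   e|bc|^2. *)
rewrite /stewart_le -subr_ge0; apply: (@ge0_of_affine _ _ (mdist b c ^+ 2)).
move=> e e01; have e01' : 0 <= e <= 1 by lra.
have [m Am cbm] := CA c b e Ac Ab e01'.
have := C1.2 x _ _ _ _ Xx Ac.1 Ab.1 Am.1 e01' cbm.
have := C2.2 y _ _ _ _ Xy Ac.2 Ab.2 Am.2 e01' cbm.
have g1 : 1 < t^-1 by rewrite invf_gt1; lra.
have := sqr_le_weighted (mdist_ge0 x y) (metric_triangle x m y) g1.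
have -> : t^-1 / (t^-1 - 1) = (1 - t)^-1 by field; lra.
rewrite /stewart_le (metric_sym y c) xc cy (metric_sym c b) (metric_sym m y).
rewrite (metric_sym y b) (metric_sym x b).
move: (mdist x y) (mdist b x) (mdist b y) (mdist b c) (mdist x m) (mdist y m).
move=> l bx bY bc xm ym H ymle xmle.
have H1 : t * (1 - t) * l ^+ 2 <= (1 - t) * xm ^+ 2 + t * ym ^+ 2.
  rewrite -ler_pdivlMl; last by rewrite mulr_gt0; lra.
  apply: (le_trans H); rewrite le_eqVlt; apply/orP; left; apply/eqP; field.
  by lra.
have t0 : 0 <= t by lra. have t1 : 0 <= 1 - t by lra.
have e0 : 0 < e by lra.
rewrite -(pmulr_rge0 _ e0).
have := ler_wpM2l t0 ymle; have := ler_wpM2l t1 xmle.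
by lra.
Qed.

(* A midline estimate: in the triangle x, b, y, where [py] crosses the
   interface at b, the points m of [xb] and c of [xy] dividing these sides in
   ratio t are at distance at most t |by|. *)
Lemma mdist_crossing_le X1 X2 t p x y c : glued_pieces X1 X2 ->
  X1 p -> X1 x -> X2 y -> (X1 `&` X2) c -> 0 < t < 1 -> at_ratio t x y c ->
  mdist p c <= (1 - t) * mdist p x + t * mdist p y.
Proof.
move=> GP Xp Xx Xy Ac t01 xyc; have [C1 _ _ cross] := GP.
have t01' : 0 <= t <= 1 by lra.
have [b Ab ->] := cross p y Xp Xy.
have [m Xm xbm] := C1.1 x b t Xx Ab.1 t01'.
have pm := mdist_ratio_le C1 Xp Xx Ab.1 Xm t01' xbm.
suff mc : mdist m c <= t * mdist b y by have := metric_triangle p m c; lra.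
(* Adding t times this inequality to the one for [c] and [m] cancels |bx|, |bc| and |xy|, leaving
   |mc|^2 <= t^2 |by|^2. *)
have := stewart_crossing_interface GP Ab Xx Xy Ac t01 xyc.
have := C1.2 c _ _ _ _ Ac.1 Xx Ab.1 Xm t01' xbm.
rewrite /stewart_le (metric_sym c x) (metric_sym c b) xyc.1.
rewrite (metric_sym x b) (metric_sym c m).
have := mdist_ge0 b y.
move: (mdist m c) (mdist b y) (mdist b c) (mdist b x) (mdist x y).
move=> mc bY bc bx l by0 mcle /(ler_wpM2l (_ : 0 <= t)) bcle.
have {}bcle := bcle ltac:(lra).
rewrite leNgt; apply/negP => ltmc.
have : (t * bY) ^+ 2 < mc ^+ 2.
  have tb0 : 0 <= t * bY by rewrite mulr_ge0//; lra.
  by rewrite ltrXn2r// nnegrE (le_trans tb0)// ltW.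
by apply/negP; rewrite -leNgt; lra.
Qed.

(* The convexity estimate at c for points of [cx] and [cy] close to c is
   equivalent to the Stewart inequality up to a term of higher order. *)
Lemma stewart_crossing X1 X2 t p x y c : glued_pieces X1 X2 ->
  X1 p -> X1 x -> X2 y -> (X1 `&` X2) c -> 0 <= t <= 1 -> at_ratio t x y c ->
  stewart_le t p x y c.
Proof.
move=> GP Xp Xx Xy Ac t01' xyc; have [C1 C2 CA _] := GP.
have [t0|t0] := leP t 0.
  have tE : t = 0 by lra.
  by move: xyc; rewrite tE => /at_ratio0 ->; exact: stewart_le0.
have [t1|t1] := leP 1 t.
  have tE : t = 1 by lra.
  move: xyc => /at_ratio_sym; rewrite tE subrr => /at_ratio0 ->.
  exact: stewart_le1.
have t01 : 0 < t < 1 by rewrite t0.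
rewrite /stewart_le -subr_ge0.
apply: (@ge0_of_affine _ _ (t * (1 - t) * mdist x y ^+ 2)) => e e01.
have e01' : 0 <= e <= 1 by lra.
have [x' Xx' cxx'] := C1.1 c x e Ac.1 Xx e01'.
have [y' Xy' cyy'] := C2.1 c y e Ac.2 Xy e01'.
have px' := C1.2 p _ _ _ _ Xp Ac.1 Xx Xx' e01' cxx'.
have py' := stewart_across GP Xp Ac.2 Xy Xy' e01' cyy'.
have [xc cy] := xyc.
have x'y'c : at_ratio t x' y' c.
  have [cx' x'x] := cxx'; have [cy' y'y] := cyy'.
  (* The path x, x', c, y', y has length |xy|, so each of its portions is shortest. *)
  suff x'y' : mdist x' y' = e * mdist x y.
    split; last by rewrite cy' cy x'y'; ring.
    by rewrite metric_sym cx' metric_sym xc x'y'; ring.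
  have := metric_triangle x' c y'; have := metric_triangle x x' y.
  have := metric_triangle x' y' y.
  rewrite cy' y'y (metric_sym x x') x'x (metric_sym x' c) cx' cy (metric_sym c x) xc.
  by lra.
have := mdist_crossing_le GP Xp Xx' Xy' Ac t01 x'y'c.
move=> /(sqr_le_convex (mdist_ge0 p c) t01').
move: px' py'; rewrite /stewart_le cy (metric_sym c x) xc.
move: (mdist p c) (mdist p x) (mdist p y) (mdist p x') (mdist p y') (mdist x y).
move=> pc px py px' py' l /(ler_wpM2l (_ : 0 <= 1 - t)) px'le.
move=> /(ler_wpM2l (_ : 0 <= t)) py'le pcle.
have e0 : 0 < e by lra.
rewrite -(pmulr_rge0 _ e0).
have {}px'le := px'le ltac:(lra); have {}py'le := py'le ltac:(lra).
by lra.
Qed.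

(** * Construction of division points in the union *)

Lemma cat0_point_same X1 X2 x y t : glued_pieces X1 X2 -> X1 x -> X1 y ->
  0 <= t <= 1 -> exists z, at_ratio t x y z /\
    forall p, (X1 `|` X2) p -> stewart_le t p x y z.
Proof.
move=> GP Xx Xy t01; have [C1 _ _ _] := GP.
have [z Xz xyz] := C1.1 x y t Xx Xy t01; exists z; split=> // p [Xp|Xp].
  exact: C1.2 Xp Xx Xy Xz t01 xyz.
exact: (stewart_across (glued_pieces_sym GP) Xp Xx Xy Xz t01 xyz).
Qed.

(** The point is taken on [xc] in ratio t/s; Stewart's inequality there, composed with the one at
    [c], gives exactly the inequality for [xy]. *)
Lemma cat0_point_crossing X1 X2 x y c s t : glued_pieces X1 X2 ->
  X1 x -> X2 y -> (X1 `&` X2) c -> at_ratio s x y c -> 0 <= t <= s -> s <= 1 ->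
  exists z, at_ratio t x y z /\
    forall p, (X1 `|` X2) p -> stewart_le t p x y z.
Proof.
move=> GP Xx Xy Ac xyc ts s1.
have [s0|s0] := leP s 0.
  have -> : t = 0 by lra.
  exists x; split=> [|p _]; last exact: stewart_le0.
  by split; rewrite ?mdistxx ?mul0r ?subr0 ?mul1r.
have r01 : 0 <= t / s <= 1 by rewrite divr_ge0/= ?ler_pdivrMr; lra.
have [z [xcz Hz]] := cat0_point_same GP Xx Ac.1 r01; exists z; split.
  have [xz zc] := xcz; have [xc cy] := xyc.
  have xzE : mdist x z = t * mdist x y by rewrite xz xc; field; lra.
  split=> //; have := metric_triangle x z y; have := metric_triangle z c y.
  have := mulfVK (lt0r_neq0 s0) t.
  by rewrite xzE zc cy xc => E; have := congr1 (fun r => r * mdist x y) E; lra.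
move=> p Xp; have s01 : 0 <= s <= 1 by lra.
have : stewart_le s p x y c.
  case: Xp => Xp; first exact: stewart_crossing GP Xp Xx Xy Ac s01 xyc.
  apply: stewart_le_sym.
  apply: (stewart_crossing (glued_pieces_sym GP) Xp Xy Xx) => //.
  - by rewrite setIC.
  - by lra.
  - exact: at_ratio_sym.
have := Hz p Xp; rewrite /stewart_le xyc.1.
move=> H /(ler_wpM2l (_ : 0 <= t / s)) H'.
have {}H' := H' ltac:(lra); apply: (le_trans H).
move: H'; rewrite -subr_ge0 => H'; rewrite -subr_ge0; apply: (le_trans H').
by rewrite le_eqVlt; apply/orP; left; apply/eqP; field; lra.
Qed.

Lemma cat0_point_other X1 X2 x y t : glued_pieces X1 X2 -> X1 x -> X2 y ->
  0 <= t <= 1 -> exists z, at_ratio t x y z /\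
    forall p, (X1 `|` X2) p -> stewart_le t p x y z.
Proof.
move=> GP Xx Xy t01; have [C1 C2 CA cross] := GP.
have [c Ac xyE] := cross x y Xx Xy.
have [xy0|xy0] := leP (mdist x y) 0.
  move: xyE; rewrite -(mdist_eq xy0) => _.
  by exists x; split=> [|p _]; rewrite /at_ratio /stewart_le mdistxx; lra.
pose s := mdist x c / mdist x y.
have sE : mdist x c = s * mdist x y by rewrite /s; field; lra.
have xyc : at_ratio s x y c by split => //; lra.
have s0 : 0 <= s by rewrite divr_ge0// mdist_ge0.
have s1 : s <= 1 by rewrite ler_pdivrMr//; have := mdist_ge0 c y; lra.
have [ts|st] := leP t s; first by apply: (cat0_point_crossing GP Xx Xy Ac xyc); lra.
(* The point now lies on [cy]: the two ends are exchanged. *)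
have Ac' : (X2 `&` X1) c by rewrite setIC.
have [||z [yxz Hz]] := @cat0_point_crossing _ _ y x c (1 - s) (1 - t)
  (glued_pieces_sym GP) Xy Xx Ac' (at_ratio_sym xyc); [lra..|].
exists z; split; first by rewrite -[t](subKr 1); exact: at_ratio_sym.
by move=> p Xp; apply: stewart_le_sym; apply: Hz; rewrite setUC.
Qed.

Lemma glued_pieces_cat0 X1 X2 : glued_pieces X1 X2 ->
  X1 `|` X2 = setT -> cat0_piece [set: X].
Proof.
move=> GP XT.
have point x y t : 0 <= t <= 1 ->
    exists z, at_ratio t x y z /\ forall p, stewart_le t p x y z.
  move=> t01; suff [z [xyz Hz]] : exists z, at_ratio t x y z /\
      forall p, (X1 `|` X2) p -> stewart_le t p x y z.
    by exists z; split=> // p; apply: Hz; rewrite XT.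
  have [Xx|Xx] : (X1 `|` X2) x by rewrite XT.
    have [Xy|Xy] : (X1 `|` X2) y by rewrite XT.
      exact: cat0_point_same.
    exact: cat0_point_other.
  rewrite setUC; have GP' := glued_pieces_sym GP.
  have [Xy|Xy] : (X1 `|` X2) y by rewrite XT.
    exact: cat0_point_other.
  exact: cat0_point_same.
split=> [x y t _ _ t01|p x y z t _ _ _ _ t01 [xz zy]].
  by have [z [xyz _]] := point x y t t01; exists z.
have [z' [_ Hz']] := point x y t t01.
(* Stewart's inequality at [z] itself forces |zz'| = 0. *)
suff -> : z = z' by exact: Hz'.
apply: mdist_eq; rewrite leNgt; apply/negP => d0.
have : 0 < mdist z z' ^+ 2 by rewrite exprn_gt0.
have := Hz' z; rewrite /stewart_le (metric_sym z x) xz zy => le0.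
by apply/negP; rewrite -leNgt; apply: (le_trans le0); lra.
Qed.

End glued_pieces.

(** * Equivalence with the comparison definition of CAT(0) *)

Section cat0_spaces.
Context {R : realType}.
Local Open Scope ring_scope.

Definition plane_pt (u v : R) : 'rV[R]_2 := \row_(i < 2) [:: u; v]`_i.

Lemma plane_dist_pt u v u' v' :
  plane_dist (plane_pt u v) (plane_pt u' v') =
  Num.sqrt ((u - u') ^+ 2 + (v - v') ^+ 2).
Proof. by rewrite /plane_dist !big_ord_recl big_ord0 !mxE/= addr0. Qed.

Lemma plane_stewart (p x y : 'rV[R]_2) t :
  plane_dist p ((1 - t) *: x + t *: y) ^+ 2 =
  (1 - t) * plane_dist p x ^+ 2 + t * plane_dist p y ^+ 2 -
  t * (1 - t) * plane_dist x y ^+ 2.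
Proof.
rewrite /plane_dist !big_ord_recl !big_ord0 !addr0.
by rewrite !sqr_sqrtr ?addr_ge0 ?sqr_ge0// !mxE; ring.
Qed.

(** The quadruple condition is applied with [z] as second apex. Its model triangle is degenerate, so
    z' is both this apex and the point of the segment. *)
Lemma cat0_space_stewart_le (X : metricType R) (p x y z : X) t :
  cat0_space X -> 0 <= t <= 1 -> at_ratio t x y z -> stewart_le t p x y z.
Proof.
move=> cat0 t01 [xz zy].
have [xy0|l0] := leP (mdist x y) 0.
  have xyE := mdist_eq xy0.
  have -> : z = x by apply/esym/mdist_eq; rewrite xz xyE mdistxx mulr0.
  by rewrite /stewart_le xyE mdistxx; lra.
have := metric_triangle p x y; have := metric_triangle p y x.
have := metric_triangle x p y; rewrite (metric_sym y x) (metric_sym x p).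
have u0 := mdist_ge0 p x; have v0 := mdist_ge0 p y => luv ulv vul.
set u := mdist p x in u0 luv ulv vul *.
set v := mdist p y in v0 luv ulv vul *.
set l := mdist x y in l0 luv ulv vul xz zy *.
(* The abscissa of p' when x' is the origin and y' = (l, 0). *)
pose h := (u ^+ 2 - v ^+ 2 + l ^+ 2) / (2 * l).
have k0 : 0 <= u ^+ 2 - h ^+ 2.
  rewrite (_ : _ - _ = ((u + l - v) * (u + l + v)) * ((v - u + l) * (v + u - l))
    / (2 * l) ^+ 2); last by rewrite /h; field; rewrite gt_eqF.
  rewrite divr_ge0 ?sqr_ge0// !mulr_ge0//; lra.
pose p' := plane_pt h (Num.sqrt (u ^+ 2 - h ^+ 2)).
pose x' := plane_pt 0 0; pose y' := plane_pt l 0.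
pose z' := (1 - t) *: x' + t *: y'.
have z'E : z' = plane_pt (t * l) 0.
  by apply/rowP => -[[|[|//]] i]; rewrite !mxE/=; ring.
have p'x' : plane_dist p' x' = u.
  rewrite plane_dist_pt !subr0 sqr_sqrtr// addrC subrK sqrtr_sqr.
  by rewrite ger0_norm.
have p'y' : plane_dist p' y' = v.
  rewrite plane_dist_pt !subr0 sqr_sqrtr//.
  rewrite (_ : _ + (_ - _) = v ^+ 2) ?sqrtr_sqr ?ger0_norm//.
  by rewrite /h; field; rewrite gt_eqF.
have dist_axis s r : plane_dist (plane_pt s 0) (plane_pt r 0) = `|s - r|.
  by rewrite plane_dist_pt subrr expr0n addr0 sqrtr_sqr.
have x'y' : plane_dist x' y' = l by rewrite dist_axis sub0r normrN gtr0_norm.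
have tl0 : 0 <= t * l by rewrite mulr_ge0 ?(ltW l0)//; lra.
have z'x' : plane_dist z' x' = mdist z x.
  by rewrite z'E dist_axis subr0 ger0_norm// metric_sym xz.
have z'y' : plane_dist z' y' = mdist z y.
  rewrite z'E dist_axis zy distrC ger0_norm; first by ring.
  by rewrite (_ : _ - _ = (1 - t) * l) ?mulr_ge0 ?(ltW l0)//; [lra|ring].
have seg : plane_segment x' y' z'.
  by exists t => //=; rewrite in_itv/=.
have := cat0 p z x y p' z' x' y' (And3 p'x' p'y' x'y') (And3 z'x' z'y' x'y') z' seg.
have -> : plane_dist z' z' = 0 by rewrite z'E dist_axis subrr normr0.
rewrite addr0 => pz.
rewrite /stewart_le -/u -/v -/l -p'x' -p'y' -x'y' -plane_stewart.
by rewrite lerXn2r// nnegrE ?mdist_ge0 ?sqrtr_ge0.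
Qed.

Lemma geodesic_at_ratio (X : metricType R) a b (gam : R -> X) p q t :
  geodesic_from_to a b gam p q -> 0 <= t <= 1 ->
  at_ratio t p q (gam (a + t * (b - a))) /\ a + t * (b - a) \in `[a, b].
Proof.
move=> [ab geo <- <-] t01.
have s0 : 0 <= t * (b - a) by rewrite mulr_ge0//; lra.
have s1 : 0 <= (1 - t) * (b - a) by rewrite mulr_ge0//; lra.
have sab : a + t * (b - a) \in `[a, b] by rewrite in_itv/=; lra.
have aab : a \in `[a, b] by rewrite in_itv/= lexx.
have bab : b \in `[a, b] by rewrite in_itv/= lexx ab.
split=> //; split; rewrite !geo// (distrC a b) (ger0_norm (_ : 0 <= b - a)) ?subr_ge0//.
  by rewrite distrC ger0_norm; lra.
by rewrite distrC ger0_norm; lra.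
Qed.

Lemma geodesic_cat0_piece (X : metricType R) :
  geodesic_space X -> cat0_space X -> cat0_piece [set: X].
Proof.
move=> geo cat0; split=> [x y t _ _ t01|p x y z t _ _ _ _ t01 xyz].
  have [a [b [gam G]]] := geo x y.
  have [xyz _] := geodesic_at_ratio G t01.
  by exists (gam (a + t * (b - a))).
exact: cat0_space_stewart_le.
Qed.

Lemma cat0_piece_cat0_space (X : metricType R) :
  cat0_piece [set: X] -> cat0_space X.
Proof.
move=> [ex st] p q x y p' q' x' y' [p'x' p'y' x'y'] [q'x' q'y' _] z' [t /=].
rewrite in_itv/= => t01 <-.
have [z _ xyz] := ex x y t I I t01.
have dist_le r r' : plane_dist r' x' = mdist r x ->
    plane_dist r' y' = mdist r y ->
    mdist r z <= plane_dist r' ((1 - t) *: x' + t *: y').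
  move=> r'x' r'y'; rewrite -(@ler_pXn2r _ 2)// ?nnegrE ?sqrtr_ge0 ?mdist_ge0//.
  by rewrite plane_stewart r'x' r'y' x'y'; exact: st.
have plane_distC (u v : 'rV[R]_2) : plane_dist u v = plane_dist v u.
  by congr Num.sqrt; apply: eq_bigr => i _; rewrite -sqrrN opprB.
rewrite plane_distC [X in _ + X]plane_distC plane_distC.
apply: (le_trans (metric_triangle p z q)); rewrite (metric_sym z q).
by rewrite lerD ?dist_le.
Qed.

(* Ratio points being unique, choosing one for every ratio yields a geodesic. *)
Lemma cat0_piece_geodesic_space (X : metricType R) :
  cat0_piece [set: X] -> geodesic_space X.
Proof.
move=> [ex st] x y; set l := mdist x y.
have [l0|l0] := leP l 0.
  rewrite -(mdist_eq l0); exists 0, 0, (fun=> x); split=> // s r.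
  by rewrite !in_itv/= => s0 r0; rewrite mdistxx (_ : s - r = 0) ?normr0//; lra.
have /choice[gam gamP] s :
    exists z, 0 <= s <= l -> at_ratio (s / l) x y z.
  have [s01|] := boolP (0 <= s <= l); last by exists x.
  have [|z _ xyz] := ex x y (s / l) I I; last by exists z.
  by rewrite divr_ge0/= ?ler_pdivrMr; lra.
have gam_dist s r : 0 <= s <= l -> 0 <= r <= l ->
    mdist (gam s) (gam r) = `|s - r|.
  move=> sl rl; have [xs sy] := gamP s sl; have [xr ry] := gamP r rl.
  have r01 : 0 <= r / l <= 1 by rewrite divr_ge0/= ?ler_pdivrMr; lra.
  apply/eqP; rewrite eq_le; apply/andP; split.
    (* Here Stewart's bound equals (s - r)^2. *)
    have := st (gam s) _ _ _ _ I I I I r01 (gamP r rl).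
    rewrite /stewart_le (metric_sym (gam s) x) xs sy -/l => H.
    rewrite -(@ler_pXn2r _ 2)// ?nnegrE ?mdist_ge0//; apply: (le_trans H).
    rewrite real_normK ?num_real// le_eqVlt; apply/orP; left; apply/eqP.
    by field; rewrite gt_eqF.
  rewrite ler_norml; apply/andP.
  have sE : mdist x (gam s) = s by rewrite xs mulfVK// gt_eqF.
  have rE : mdist x (gam r) = r by rewrite xr mulfVK// gt_eqF.
  have := metric_triangle x (gam s) (gam r).
  have := metric_triangle x (gam r) (gam s).
  by rewrite (metric_sym (gam r) (gam s)) sE rE; lra.
have ll : 0 <= l <= l by lra.
have l00 : 0 <= (0 : R) <= l by lra.
exists 0, l, gam; split; first exact: ltW.
- by move=> s r; rewrite !in_itv/=; exact: gam_dist.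
- apply/esym/mdist_eq; have [-> _] := gamP 0 l00.
  by rewrite !mul0r.
- apply: mdist_eq; have [_ ->] := gamP l ll.
  by rewrite divff ?gt_eqF// subrr mul0r.
Qed.

End cat0_spaces.

(** * Transfer along distance-preserving maps *)

Section isometric_embeddings.
Context {R : realType} {X Y : metricType R} (f : X -> Y).
Hypothesis f_dist : forall x y, mdist (f x) (f y) = mdist x y.
Local Open Scope ring_scope.

Lemma isometric_continuous : continuous f.
Proof.
move=> x; apply/cvg_ballP => e e0; apply/nbhs_ballP; exists e => //= y.
by rewrite !ballEmdist /= f_dist.
Qed.

Lemma isometric_at_ratio t x y z :
  at_ratio t x y z -> at_ratio t (f x) (f y) (f z).
Proof. by rewrite /at_ratio !f_dist. Qed.

Lemma isometric_cat0_piece : cat0_piece [set: X] -> cat0_piece (range f).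
Proof.
move=> [ex st]; split.
  move=> _ _ t [x _ <-] [y _ <-] t01; have [z _ xyz] := ex x y t I I t01.
  by exists (f z); [exists z | exact: isometric_at_ratio].
move=> _ _ _ _ t [p _ <-] [x _ <-] [y _ <-] [z _ <-] t01.
by rewrite /at_ratio /stewart_le !f_dist; exact: st.
Qed.

Lemma isometric_proper (B : set Y) : proper_space X ->
  closed B -> bounded_subset B -> compact (B `&` range f).
Proof.
move=> Xp Bc [M BM]; rewrite (_ : B `&` _ = f @` (f @^-1` B)).
  apply: continuous_compact.
    by apply: continuous_subspaceT => x; exact: isometric_continuous.
  apply: Xp.
    apply: preimage_closed => //; apply: in1W; exact: isometric_continuous.
  by exists M => x y Bx By; rewrite -f_dist; exact: BM.
by apply/seteqP; split=> [y [By [x _ fx]]|_ [x Bx <-]];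
  [exists x => //=; rewrite fx | split=> //; exists x].
Qed.

End isometric_embeddings.

(** * The gluing as the union of the images of both spaces *)

Theorem mainTheorem1 (R : realType) (U1 U2 : metricType R)
    (A1 : set U1) (A2 : set U2) (iota : U1 -> U2)
    (U1_proper : proper_space U1) (U1_geodesic : geodesic_space U1)
    (U1_cat0 : cat0_space U1)
    (U2_proper : proper_space U2) (U2_geodesic : geodesic_space U2)
    (U2_cat0 : cat0_space U2)
    (A1_neq0 : A1 !=set0) (A1_closed : closed A1) (A1_convex : convex_subset A1)
    (A2_neq0 : A2 !=set0) (A2_closed : closed A2) (A2_convex : convex_subset A2)
    (iota_isometry : isometry_between A1 A2 iota) :
  let W := gluing A1_neq0 A1_closed iota_isometry in
  [/\ proper_space W, geodesic_space W & cat0_space W].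
Proof.
move=> W.
pose f1 : U1 -> W := @gluing_inl _ _ _ _ _ _ A1_neq0 A1_closed iota_isometry.
pose f2 : U2 -> W := @gluing_inr _ _ _ _ _ _ A1_neq0 A1_closed iota_isometry.
have f1_dist x y : mdist (f1 x) (f1 y) = mdist x y by exact: gluing_dist11.
have f2_dist x y : mdist (f2 x) (f2 y) = mdist x y by exact: gluing_dist22.
have WE : range f1 `|` range f2 = [set: W].
  apply/seteqP; split=> // p _.
  have [[x ->]|[x ->]] := gluingP (p : gluing A1_neq0 A1_closed iota_isometry).
    by left; exists x.
  by right; exists x.
have f12 x y : f1 x = f2 y <-> A1 x /\ y = iota x by exact: gluing_inl_inr.
have f1A a : A1 a -> f1 a = f2 (iota a) by move=> A1a; apply/f12.
have AE : range f1 `&` range f2 = f1 @` A1.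
  apply/seteqP; split=> [_ [[x _ <-] [y _ /esym/f12[A1x _]]]|_ [x A1x <-]].
    by exists x.
  by split; [exists x | exists (iota x) => //; rewrite f1A].
have W_cat0 : cat0_piece [set: W].
  apply: (@glued_pieces_cat0 _ _ (range f1) (range f2)); last exact: WE.
  split.
  - exact/(isometric_cat0_piece f1_dist)/geodesic_cat0_piece.
  - exact/(isometric_cat0_piece f2_dist)/geodesic_cat0_piece.
  (* By convexity, a geodesic of [U1] between points of [A1] stays in the interface. *)
  - rewrite AE => _ _ t [x A1x <-] [y A1y <-] t01.
    have [a [b [gam G]]] := U1_geodesic x y.
    have [xyz tab] := geodesic_at_ratio G t01; exists (f1 (gam (a + t * (b - a))%R)).
      by exists (gam (a + t * (b - a))%R) => //; exact: A1_convex G _ tab.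
    exact: isometric_at_ratio.
  - rewrite AE => _ _ [x _ <-] [y _ <-].
    have [a A1a [xyE _]] := gluing_dist12_min A1_neq0 A1_closed iota_isometry x y
      U1_proper.
    exists (f1 a); first by exists a.
    by rewrite f1_dist (f1A a A1a) f2_dist (metric_sym (iota a)); exact: xyE.
split; last exact: cat0_piece_cat0_space; last exact: cat0_piece_geodesic_space.
move=> B Bc Bb; rewrite -[B]setIT -WE setIUr.
by apply: compactU; [exact: (isometric_proper f1_dist) |
  exact: (isometric_proper f2_dist)].
Qed.
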